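(* Let $(X,d)$ be a compact metric space with Borel $\sigma$-algebra $\mathcal{B}$, and let $v:\mathcal{B}\to\mathbb{R}$ be a sub-additive capacity. Then the following two properties are equivalent: (i) for every sequence $(O_n)_{n\in\mathbb{N}}$ of open subsets of $X$ with $O_n\downarrow O$, one has $\lim_{n\to\infty} v(O_n)=v(O)$; (ii) for every $\varepsilon>0$ and every Borel measurable function $u:X\to\mathbb{R}$ there exists a compact set $K=K(u,\varepsilon)\subseteq X$ such that $v(X\setminus K)\le\varepsilon$ and the restriction $u|_K$ is continuous.
   Context: A capacity on a metric space $X$ with Borel $\sigma$-algebra $\mathcal{B}$ is a set function $v:\mathcal{B}\to\mathbb{R}$ such that: (1) $v(\emptyset)=0$ and $v(X)=1$; (2) $A\subseteq B$ implies $v(A)\le v(B)$, for $A,B\in\mathcal{B}$; (3) if $A_n\in\mathcal{B}$ and $A_n\uparrow A$ (i.e. $A_n\subseteq A_{n+1}$ for all $n$ and $A=\bigcup_n A_n$), then $\lim_{n\to\infty}v(A_n)=v(A)$. A capacity $v$ is sub-additive if $v(A\cup B)\le v(A)+v(B)$ for all $A,B\in\mathcal{B}$. The notation $O_n\downarrow O$ means $O_{n+1}\subseteq O_n$ for all $n$ and $O=\bigcap_n O_n$ (so $O$ is a Borel set, not necessarily open). *)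

(* Defs.v *)
From mathcomp Require Import all_boot all_order all_algebra.
From mathcomp Require Import all_classical all_reals all_analysis.

Set Implicit Arguments.
Unset Strict Implicit.
Unset Printing Implicit Defensive.

Import Order.TTheory GRing.Theory Num.Theory.
Import numFieldNormedType.Exports.

Local Open Scope classical_set_scope.
Local Open Scope ring_scope.

Definition borel (X : topologicalType) : set (set X) := <<s [set A | open A] >>.

(* [measurable_fun setT u] unfolded: the library's measurable types are pointed,
   and a metric space need not be. *)
Definition borel_fun (R : realType) (X : topologicalType) (u : X -> R) : Prop :=
  forall Y : set R, measurable Y -> borel (u @^-1` Y).

(* As for measures in the library, a set function is total on [set X]; only its
   values on Borel sets are constrained. *)
Record capacity (R : realType) (X : topologicalType) (v : set X -> R) : Prop :=
  Capacity {
    capacity0 : v set0 = 0;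
    capacityT : v [set: X] = 1;
    le_capacity : forall A B : set X,
      borel A -> borel B -> A `<=` B -> v A <= v B;
    capacity_cvg : forall A : nat -> set X,
      (forall n, borel (A n)) -> (forall n, A n `<=` A n.+1) ->
      v (A n) @[n --> \oo] --> v (\bigcup_n A n)
  }.

Definition sub_additive (R : realType) (X : topologicalType)
    (v : set X -> R) : Prop :=
  forall A B : set X, borel A -> borel B -> v (A `|` B) <= v A + v B.

(* Main.v *)
(** Countable sub-additivity turns (i) into regularity: the sets [B] squeezed as
    [F `<=` B `<=` O] with [F] closed, [O] open and [v (O `\` F)] small form a
    sigma-algebra containing the open sets.  Squeezing every [u @^-1` `]q, +oo[],
    [q] rational, and removing all the gaps [O `\` F] leaves a closed set on which
    all these preimages are relatively clopen, so that [u] is continuous there.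

    Conversely, let [u] be [n] on the shell [O n `\` O n.+1].  If [u] is continuous
    on the compact set [K], it is bounded there, so [K] misses
    [O n `\` \bigcap_n O n] for large [n], and the capacity of the latter is at
    most [v (~` K)]. *)
Require Import Defs.
From mathcomp Require Import all_boot all_order all_algebra.
From mathcomp Require Import all_classical all_reals all_analysis.

Import Order.TTheory GRing.Theory Num.Theory.
Import numFieldNormedType.Exports.

Local Open Scope classical_set_scope.
Local Open Scope ring_scope.

(** * Closure properties of Borel sets *)

Lemma borel_open {X : topologicalType} (A : set X) : open A -> borel A.
Proof. by move=> oA; exact: sub_sigma_algebra. Qed.

Lemma borelC {X : topologicalType} (A : set X) : borel A -> borel (~` A).
Proof. by rewrite -setTD; exact: sigma_algebraCD. Qed.

Lemma borel_bigcup {X : topologicalType} (P : set nat) (A : nat -> set X) :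
  (forall n, borel (A n)) -> borel (\bigcup_(n in P) A n).
Proof.
move=> bA; rewrite bigcup_mkcond; apply: sigma_algebra_bigcup => n.
by case: ifP => _; [exact: bA | exact: sigma_algebra0].
Qed.

Lemma borel_bigcap {X : topologicalType} (A : nat -> set X) :
  (forall n, borel (A n)) -> borel (\bigcap_n A n).
Proof.
move=> bA; rewrite -[X in borel X]setCK setC_bigcap.
by apply: borelC; apply: borel_bigcup => n; exact: borelC.
Qed.

Lemma borelU {X : topologicalType} (A B : set X) :
  borel A -> borel B -> borel (A `|` B).
Proof.
move=> bA bB; rewrite -bigcup2E; apply: borel_bigcup => -[|[|n]] //.
exact: sigma_algebra0.
Qed.

Lemma borelD {X : topologicalType} (A B : set X) :
  borel A -> borel B -> borel (A `\` B).
Proof.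
move=> bA bB; rewrite setDE -[X in borel X]setCK setCI setCK.
by apply: borelC; apply: borelU => //; exact: borelC.
Qed.

Lemma borel_closed {X : topologicalType} (A : set X) : closed A -> borel A.
Proof.
move=> cA; rewrite -[A]setCK.
by apply: borelC; apply: borel_open; exact: closed_openC.
Qed.

(** Finite sub-additivity bounds the partial unions by a geometric sum, and continuity from below
    carries the bound to the whole union. *)
Lemma capacity_bigcup_le {R : realType} {X : topologicalType} (v : set X -> R)
    (A : nat -> set X) (e : R) :
  capacity v -> sub_additive v ->
  (forall n, borel (A n)) -> (forall n, v (A n) <= e / 2 ^+ n.+1) ->
  v (\bigcup_n A n) <= e.
Proof.
move=> capv subv bA vA.
pose B n := \bigcup_(i < n) A i.
have bB n : borel (B n) by exact: borel_bigcup.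
have BS n : B n.+1 = B n `|` A n.
  by rewrite /B !bigcup_mkord big_ord_recr.
have vB n : v (B n) <= e - e / 2 ^+ n.
  elim: n => [|n IHn].
    by rewrite /B bigcup_mkord big_ord0 (capacity0 capv) expr0 divr1 subrr.
  rewrite BS (le_trans (subv _ _ (bB n) (bA n)))// (le_trans (lerD IHn (vA n)))//.
  suff -> : e / 2 ^+ n = e / 2 ^+ n.+1 + e / 2 ^+ n.+1.
    by rewrite opprD addrA subrK.
  by rewrite exprSr invfM mulrA -splitr.
have e0 : 0 <= e.
  have : 0 <= e / 2 ^+ 1.
    apply: le_trans (vA 0%N); rewrite -(capacity0 capv).
    by apply: (le_capacity capv) => //; exact: sigma_algebra0.
  by rewrite pmulr_lge0// invr_gt0.
have -> : \bigcup_n A n = \bigcup_n B n.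
  apply/seteqP; split=> [x [n _ Anx]|x [n _ [i _ Aix]]]; last by exists i.
  by exists n.+1 => //; exists n => /=.
have incB n : B n `<=` B n.+1 by rewrite BS; exact: subsetUl.
apply: (cvgr_to_le (capacity_cvg capv bB incB)).
near=> n; apply: le_trans (vB n) _.
by rewrite gerBl divr_ge0// exprn_ge0.
Unshelve. all: by end_near. Qed.

(** Take the union of the balls of radius [1 / (n + 1)] centred in [C]. Interiors are used because a
    ball of a pseudometric type need not be open. *)
Lemma closed_bigcap_open {R : realType} {X : pseudoMetricType R} (C : set X) :
  closed C -> exists O : nat -> set X,
    [/\ forall n, open (O n), forall n, O n.+1 `<=` O n & \bigcap_n O n = C].
Proof.
move=> cC; exists (fun n => \bigcup_(x in C) (ball x n.+1%:R^-1)°); split.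
- by move=> n; apply: bigcup_open => x _; exact: open_interior.
- move=> n; apply: subset_bigcup => x _; apply: interiorS; apply: le_ball.
  by rewrite lef_pV2 ?posrE// ler_nat.
- apply/seteqP; split=> [y Oy|y Cy n _]; last first.
    by exists y => //; apply: nbhsx_ballx; rewrite invr_gt0.
  rewrite (closure_id C).1// => B /nbhs_ballP[e /= e0 yeB].
  have [N _ Ne] := near_infty_natSinv_lt (PosNum e0).
  have [x Cx /interior_subset xy] := Oy N I.
  exists x; split=> //; apply: yeB; apply: ball_sym; apply: le_ball xy.
  exact/ltW/(Ne N)/leqnn.
Qed.

(** * Regularity and the Lusin property *)

Definition outer_continuous {R : realType} {X : topologicalType}
    (v : set X -> R) : Prop :=
  forall O : nat -> set X,
    (forall n, open (O n)) -> (forall n, O n.+1 `<=` O n) ->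
    v (O n) @[n --> \oo] --> v (\bigcap_n O n).

(** The gap itself must be small: as [v] is only sub-additive, close values on [F] and [O] would not
    ensure this. Pairing the two sets lets one [choice] select both along a sequence. *)
Definition squeezed {R : realType} {X : topologicalType} (v : set X -> R)
    (B : set X) : Prop :=
  forall e : R, 0 < e -> exists FO : set X * set X,
    [/\ closed FO.1, open FO.2, FO.1 `<=` B, B `<=` FO.2 &
        v (FO.2 `\` FO.1) <= e].

Section regularity.
Context {R : realType} {X : pseudoMetricType R} (v : set X -> R).
Hypotheses (capv : capacity v) (subv : sub_additive v)
  (contv : outer_continuous v).

(** With open sets [V n] decreasing to [~] U[, the open sets]U [&] V n[decrease to the empty set, so
    their capacities tend to 0;]~[V N] is the inner closed set. *)
Lemma squeezed_open (U : set X) : open U -> squeezed v U.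
Proof.
move=> oU e e0.
have [V [oV decV VU]] := closed_bigcap_open _ (open_closedC oU).
have cap0 : \bigcap_n (U `&` V n) = set0.
  rewrite bigcapIr; last by exists 0%N.
  by rewrite VU setICr.
have cvU : v (U `&` V n) @[n --> \oo] --> (0 : R).
  rewrite -(capacity0 capv) -cap0; apply: contv => [n|n].
    exact: openI.
  exact: setIS.
have [N _ /(_ N (leqnn N)) vN] := cvgr_le _ cvU e e0.
exists (~` V N, U); split=> //=; first exact: open_closedC.
- by rewrite -[U in _ `<=` U]setCK; apply: subsetC; rewrite -VU => x; apply.
- by rewrite setDE setCK.
Qed.

Lemma squeezedC (B : set X) : squeezed v B -> squeezed v (~` B).
Proof.
move=> sB e /sB[[F O] /= [cF oO FB BO vFO]].
exists (~` O, ~` F); split=> /=.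
- exact: open_closedC.
- exact: closed_openC.
- exact: subsetC.
- exact: subsetC.
- by rewrite setDE setCK setIC -setDE.
Qed.

(** The union of all inner sets need not be closed, so only finitely many are kept. The open sets
    [O]\[F N] decrease to a set covered by the gaps, and outer continuity provides a suitable
    [N]. *)
Lemma squeezed_bigcup (B : nat -> set X) :
  (forall n, squeezed v (B n)) -> squeezed v (\bigcup_n B n).
Proof.
move=> sB e e0.
have e20 : 0 < e / 2 by rewrite divr_gt0.
have /choice[FO HFO] n := sB n _ (divr_gt0 e20 (exprn_gt0 n.+1 (@ltr0Sn R 1))).
pose O := \bigcup_n (FO n).2.
pose F N := \bigcup_(n < N) (FO n).1.
have oO : open O by apply: bigcup_open => n _; case: (HFO n).
have cF N : closed (F N).
  by rewrite /F bigcup_mkord; apply: closed_bigsetU => n _; case: (HFO n).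
(* The gaps sum to [e / 2], so the limit is strictly below [e] and some term is at most [e]. *)
have vOF : v (\bigcap_N (O `\` F N)) < e.
  apply: (@le_lt_trans _ _ (e / 2)); last first.
    by rewrite ltr_pdivrMr// ltr_pMr// ltr1n.
  have bOF n : borel ((FO n).2 `\` (FO n).1).
    have [cFn oOn _ _ _] := HFO n.
    by apply: borelD; [exact: borel_open|exact: borel_closed].
  apply: (@le_trans _ _ (v (\bigcup_n ((FO n).2 `\` (FO n).1)))).
    apply: (le_capacity capv) => [||x OFx]; [|exact: borel_bigcup|].
      apply: borel_bigcap => N.
      by apply: borelD; [exact: borel_open|exact: borel_closed].
    have [[n _ Onx] _] := OFx 0%N I.
    exists n => //; split=> // Fnx.
    by have [_] := OFx n.+1 I; apply; exists n => /=.
  by apply: capacity_bigcup_le => // n; case: (HFO n).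
have cvO : v (O `\` F n) @[n --> \oo] --> v (\bigcap_N (O `\` F N)).
  apply: contv => n; first by rewrite setDE; apply: openI => //; exact: closed_openC.
  apply: setDS => x [i /= lin Fix]; exists i => //=.
  exact: ltnW.
have [N _ /(_ N (leqnn N)) vN] := cvgr_le _ cvO _ vOF.
exists (F N, O); split=> //=.
- by move=> x [n _ Fnx]; exists n => //; have [_ _ + _ _] := HFO n; apply.
- by apply: subset_bigcup => n _; case: (HFO n).
Qed.

Lemma borel_squeezed (B : set X) : borel B -> squeezed v B.
Proof.
move=> bB; apply: (smallest_sub _ _ bB) => [|A]; last exact: squeezed_open.
split; first exact/squeezed_open/open0.
- by move=> A sA; rewrite setTD; exact: squeezedC.
- exact: squeezed_bigcup.
Qed.

Lemma lusin (e : R) (u : X -> R) : 0 < e -> borel_fun u ->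
  exists K : set X,
    [/\ closed K, v (~` K) <= e & {within K, continuous u}].
Proof.
move=> e0 bu.
(* An enumeration of the rationals; a code of no rational yields 0, which merely repeats a level. *)
pose q n : R := ratr (odflt 0 (unpickle n)).
have bq n : borel (u @^-1` `]q n, +oo[) by apply: bu; exact: measurable_itv.
have /choice[FO HFO] n :=
  borel_squeezed _ (bq n) _ (divr_gt0 e0 (exprn_gt0 n.+1 (@ltr0Sn R 1))).
have oOF n : open ((FO n).2 `\` (FO n).1).
  have [cF oO _ _ _] := HFO n.
  by rewrite setDE; apply: openI => //; exact: closed_openC.
exists (~` (\bigcup_n ((FO n).2 `\` (FO n).1))); split.
- by apply: open_closedC; apply: bigcup_open.
- rewrite setCK; apply: capacity_bigcup_le => // n; first exact: borel_open.
  by case: (HFO n).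
set K := ~` _; apply/subspace_continuousP => x Kx.
(* On [K] the inner and outer sets of level [r] coincide with the points where [u] exceeds [r]. *)
have FOq (r : rat) : let p := FO (pickle r) in
    [/\ closed p.1, open p.2, forall y, p.1 y -> ratr r < u y,
        forall y, ratr r < u y -> p.2 y & forall y, K y -> p.2 y -> p.1 y].
  have [cF oO Fq qO _] := HFO (pickle r); split=> //= y.
  - by move/Fq; rewrite /= /q pickleK /= in_itv/= andbT.
  - by move=> ry; apply: qO; rewrite /= /q pickleK /= in_itv/= andbT.
  - move=> Ky Oy; apply: contrapT => nFy; apply: Ky.
    by exists (pickle r).
apply/cvgrPdist_lt => d d0.
have [r] := @rat_in_itvoo _ (u x - d) (u x) ltac:(by rewrite ltrBlDr ltrDl).
rewrite in_itv/= => /andP[dr rx].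
have [r'] := @rat_in_itvoo _ (u x) (u x + d) ltac:(by rewrite ltrDl).
rewrite in_itv/= => /andP[xr' r'd].
have [_ oO Fr rO KOF] := FOq r.
have [cF' _ Fr' rO' KOF'] := FOq r'.
(* On this open set, points of [K] satisfy [r < u y <= r'], within [d] of [u x]. *)
have nbhsOF : nbhs x ((FO (pickle r)).2 `\` (FO (pickle r')).1).
  apply: open_nbhs_nbhs; split.
    by rewrite setDE; apply: openI => //; exact: closed_openC.
  split; first exact: rO.
  by move=> /Fr'; rewrite ltNge (ltW xr').
apply: filterS nbhsOF => y [Oy nFy] Ky.
have ry : ratr r < u y by apply/Fr/KOF.
have yr' : u y <= ratr r'.
  by rewrite leNgt; apply/negP => /rO'/(KOF' _ Ky).
rewrite ltr_distlC (lt_trans dr ry)/=.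
exact: le_lt_trans r'd.
Qed.

End regularity.

(** * From the Lusin property to outer continuity *)

Lemma subset_nonincreasing {T : Type} (O : nat -> set T) :
  (forall n, O n.+1 `<=` O n) -> forall i j, (i <= j)%N -> O j `<=` O i.
Proof.
move=> Odec i j /subnK <-; elim: (j - i)%N => // k IHk.
by rewrite addSn => y /Odec /IHk.
Qed.

Section converse.
Context {R : realType} {X : topologicalType} (v : set X -> R).
Hypotheses (capv : capacity v) (subv : sub_additive v).

(* Off the shells [xget] returns its default value [0]. *)
Definition shell_index (O : nat -> set X) (x : X) : R :=
  (xget 0%N [set n | (O n `\` O n.+1) x])%:R.

(** The shells of a decreasing sequence are disjoint, so [xget] has only one candidate. *)
Lemma shell_indexE (O : nat -> set X) (n : nat) (x : X) :
  (forall n, O n.+1 `<=` O n) -> (O n `\` O n.+1) x ->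
  shell_index O x = n%:R.
Proof.
move=> Odec Onx; congr (_%:R); apply: xget_unique => //= m [Omx nOmx].
case: Onx => Onx nOnx; case: (ltngtP m n) => // [mn|nm].
- by case: nOmx; exact: subset_nonincreasing _ Odec _ _ mn _ Onx.
- by case: nOnx; exact: subset_nonincreasing _ Odec _ _ nm _ Omx.
Qed.

Lemma borel_shell_index (O : nat -> set X) :
  (forall n, borel (O n)) -> (forall n, O n.+1 `<=` O n) ->
  borel_fun (shell_index O).
Proof.
move=> bO Odec Y _.
have bS n : borel (O n `\` O n.+1) by exact: borelD.
(* The points of [\bigcap_n O n] and those outside [O 0], where the index is 0 by default. *)
pose rest := ~` \bigcup_n (O n `\` O n.+1).
have brest : borel rest by apply: borelC; exact: borel_bigcup.
have -> : shell_index O @^-1` Y =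
    \bigcup_(n in [set n | Y n%:R]) (O n `\` O n.+1) `|`
    (if `[< Y 0 >] then rest else set0).
  apply/seteqP; split=> x /=.
    have [[n _ Snx]|nSx] := pselect ((\bigcup_n (O n `\` O n.+1)) x).
      by rewrite (shell_indexE _ n)// => Yn; left; exists n.
    rewrite /shell_index; case: xgetP => [n _ Snx|_ Y0].
      by case: nSx; exists n.
    by right; case: asboolP.
  case=> [[n /= Yn Snx]|]; first by rewrite (shell_indexE _ n).
  case: asboolP => // Y0 restx; rewrite /shell_index.
  by case: xgetP => // n _ Snx; case: restx; exists n.
apply: borelU; first exact: borel_bigcup.
by case: asboolP => _ //; exact: sigma_algebra0.
Qed.

(** The premise supplies [borel K] since a compact set of a general topological space need not be
    Borel. *)
Lemma lusin_outer_continuous (O : nat -> set X) :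
  (forall (e : R) (u : X -> R), 0 < e -> borel_fun u ->
     exists K : set X,
       [/\ compact K, borel K, v (~` K) <= e & {within K, continuous u}]) ->
  (forall n, borel (O n)) -> (forall n, O n.+1 `<=` O n) ->
  v (O n) @[n --> \oo] --> v (\bigcap_n O n).
Proof.
move=> lus bO Odec; apply/cvgrPdist_le => e e0.
have [K [cK bK vK uK]] := lus e _ e0 (borel_shell_index _ bO Odec).
(* Every real above [M] bounds the index on [K]; [M + 1] is used below. *)
have [M [_ HM]] := compact_bounded (continuous_compact uK cK).
have bcap : borel (\bigcap_n O n) by exact: borel_bigcap.
near=> n.
have nM : M + 1 < n%:R by near: n; exact: nbhs_infty_gtr.
have shellK : O n `\` \bigcap_n O n `<=` ~` K.
  move=> x [Onx nOx] Kx.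
  (* A point of [O n] on no later shell would stay in every [O k] by induction. *)
  have [m nm [Omx nOmx]] : exists2 m, (n <= m)%N & (O m `\` O m.+1) x.
    apply: contrapT => noshell; apply: nOx => k _.
    have Onk : O (n + k)%N x.
      elim: k => [|k IHk]; first by rewrite addn0.
      rewrite addnS; apply: contrapT => nOS; apply: noshell.
      by exists (n + k)%N; [exact: leq_addr|].
    exact: subset_nonincreasing _ Odec _ _ (leq_addl n k) _ Onk.
  have := HM (M + 1) ltac:(by rewrite ltrDl) _ (ex_intro2 _ _ x Kx erefl).
  rewrite (shell_indexE _ m)//= normr_nat leNgt => /negP; apply.
  by apply: lt_le_trans nM _; rewrite ler_nat.
have capO : v (\bigcap_n O n) <= v (O n).
  by apply: (le_capacity capv) => // x; exact.
rewrite ler0_norm ?subr_le0// opprB lerBlDl.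
have OE : O n = \bigcap_n O n `|` (O n `\` \bigcap_n O n).
  by rewrite setUDr setDv setD0 setUC setUidl// => x; exact.
have bD : borel (O n `\` \bigcap_n O n) by exact: borelD.
rewrite [in leLHS]OE (le_trans (subv _ _ bcap bD))// lerD2l.
by apply: le_trans vK; apply: (le_capacity capv) => //; exact: borelC.
Unshelve. all: by end_near. Qed.

End converse.

Theorem theorem1p2 (R : realType) (X : metricType R)
    (compactX : compact [set: X]) (v : set X -> R)
    (capv : capacity v) (subv : sub_additive v) :
  (forall O : nat -> set X,
     (forall n, open (O n)) -> (forall n, O n.+1 `<=` O n) ->
     v (O n) @[n --> \oo] --> v (\bigcap_n O n))
  <->
  (forall (e : R) (u : X -> R), 0 < e -> borel_fun u ->
     exists K : set X,
       [/\ compact K, v (~` K) <= e & {within K, continuous u}]).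
Proof.
split=> [contv e u e0 bu|lus O oO Odec].
  have [K [cK vK uK]] := lusin v capv subv contv e u e0 bu.
  (* Compactness of [X] makes the closed set [K] compact. *)
  by exists K; split=> //; exact: subclosed_compact cK compactX _.
apply: lusin_outer_continuous => // [e u e0 bu|n]; last exact: borel_open.
have [K [cK vK uK]] := lus e u e0 bu.
(* A metric space is Hausdorff, so the compact set [K] is closed, hence Borel. *)
exists K; split=> //; apply: borel_closed; apply: compact_closed => //.
exact: metric_hausdorff.
Qed.
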